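(* Let $\Omega\subseteq\mathbb R^3$ be an arbitrary open set. The Hans Lewy operator $L^*(x,\partial):\mathcal D^*(\Omega)\to\mathcal D^*(\Omega)$, $$L^*(x,\partial)=\frac{\partial}{\partial x_1}+i\frac{\partial}{\partial x_2}-2i(x_1+ix_2)\frac{\partial}{\partial x_3},$$ is regular. Consequently, it is surjective on $\mathcal D^*(\Omega)$: for every $T\in\mathcal D^*(\Omega)$ the equation $L^*(x,\partial)U=T$ has a solution $U\in\mathcal D^*(\Omega)$.
   Context: $\mathcal D(\Omega)=\mathcal C_0^\infty(\Omega)$ is the $\mathbb C$-vector space of smooth compactly supported functions $\Omega\to\mathbb C$ and $\mathcal D^*(\Omega)$ is its algebraic dual (all $\mathbb C$-linear functionals), with evaluation $\langle T,\varphi\rangle$. For $f\in\mathcal C^\infty(\Omega)$, $\langle fT,\varphi\rangle=\langle T,f\varphi\rangle$; for a multi-index $\alpha$, $\langle\partial^\alpha T,\varphi\rangle=(-1)^{|\alpha|}\langle T,\partial^\alpha\varphi\rangle$. Regular: a linear operator $\mathcal O^*$ on the algebraic dual $V^*$ of a vector space $V$ is regular if there is an injective linear operator $\mathcal O:V\to V$ (its co-dual) with $\mathcal O^*(T)=T\circ\mathcal O$ for all $T\in V^*$. For a differential operator $\sum_\alpha c_\alpha\partial^\alpha$ on $\mathcal D^*(\Omega)$ with smooth coefficients, the co-dual is the operator $\varphi\mapsto\sum_\alpha(-1)^{|\alpha|}\partial^\alpha(c_\alpha\varphi)$ on $\mathcal D(\Omega)$. *)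

(* Defs.v *)
From HB Require Import structures.
From mathcomp Require Import all_boot all_order all_algebra.
From mathcomp Require Import complex.
From mathcomp Require Import all_classical all_reals all_analysis.

Set Implicit Arguments.
Unset Strict Implicit.
Unset Printing Implicit Defensive.

Import Order.TTheory GRing.Theory Num.Theory.
Import numFieldNormedType.Exports.

Local Open Scope classical_set_scope.
Local Open Scope ring_scope.
Local Open Scope complex_scope.

(* The module structure on linear maps is pointwise; the eqType and choiceType
   structures it requires are the classical ones. *)
Section LinearMaps.
Variables (K : comNzRingType) (U V : lmodType K).
Implicit Types f g h : {linear U -> V}.

HB.instance Definition _ := gen_eqMixin {linear U -> V}.
HB.instance Definition _ := gen_choiceMixin {linear U -> V}.

Lemma linmap_ext f g : (forall u, f u = g u) -> f = g.
Proof.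
case: f g => f [[fA] [fB]] [g [[gA] [gB]]] /= /funext efg; subst g.
by rewrite (Prop_irrelevance fA gA) (Prop_irrelevance fB gB).
Qed.

Definition linmap_add f g : {linear U -> V} := f \+ g.
Definition linmap_opp f : {linear U -> V} := \- f.
Definition linmap_zero : {linear U -> V} := \0.
Definition linmap_scale (a : K) f : {linear U -> V} := a \*: f.

Lemma linmap_addA : associative linmap_add.
Proof. by move=> f g h; apply: linmap_ext => u /=; rewrite addrA. Qed.

Lemma linmap_addC : commutative linmap_add.
Proof. by move=> f g; apply: linmap_ext => u /=; rewrite addrC. Qed.

Lemma linmap_add0 : left_id linmap_zero linmap_add.
Proof. by move=> f; apply: linmap_ext => u /=; rewrite add0r. Qed.

Lemma linmap_addN : left_inverse linmap_zero linmap_opp linmap_add.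
Proof. by move=> f; apply: linmap_ext => u /=; rewrite addNr. Qed.

HB.instance Definition _ := GRing.isZmodule.Build {linear U -> V}
  linmap_addA linmap_addC linmap_add0 linmap_addN.

Lemma linmap_scaleA a b f :
  linmap_scale a (linmap_scale b f) = linmap_scale (a * b) f.
Proof. by apply: linmap_ext => u /=; rewrite scalerA. Qed.

Lemma linmap_scale1 : left_id 1 linmap_scale.
Proof. by move=> f; apply: linmap_ext => u /=; rewrite scale1r. Qed.

Lemma linmap_scaleDr : right_distributive linmap_scale +%R.
Proof. by move=> a f g; apply: linmap_ext => u /=; rewrite scalerDr. Qed.

Lemma linmap_scaleDl f : {morph linmap_scale^~ f : a b / a + b}.
Proof. by move=> a b; apply: linmap_ext => u /=; rewrite scalerDl. Qed.

HB.instance Definition _ := GRing.Zmodule_isLmodule.Build K {linear U -> V}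
  linmap_scaleA linmap_scale1 linmap_scaleDr linmap_scaleDl.

End LinearMaps.

(* The algebraic dual: all linear forms, without any continuity condition. *)
Notation dual V := {linear V -> GRing.regular _}.

Section Dual.
Variables (K : fieldType) (V : lmodType K).

Definition transpose (O : {linear V -> V}) (T : dual V) : dual V := T \o O.

Lemma transpose_is_linear O : linear (transpose O).
Proof. by move=> a S T; apply: linmap_ext. Qed.

HB.instance Definition _ O :=
  GRing.isLinear.Build K (dual V) (dual V) _ (transpose O)
    (transpose_is_linear O).

Definition regular (Ostar : {linear dual V -> dual V}) : Prop :=
  exists O : {linear V -> V},
    injective O /\ forall T : dual V, Ostar T = T \o O.

End Dual.

Section Smooth.
Variables (R : realType) (n : nat).
Local Notation E := 'rV[R]_n.
Implicit Types (A B Omega : set E) (f g : E -> R) (j : 'I_n).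

Definition partial j f : E -> R := fun x => 'D_'e_j f x.

Fixpoint Ck A (k : nat) f : Prop :=
  (forall x, A x -> {for x, continuous f}) /\
  if k is k'.+1 then
    forall j, (forall x, A x -> derivable f x 'e_j) /\
              Ck A k' (partial j f)
  else True.

Definition smooth A f : Prop := forall k, Ck A k f.

Lemma near_continuous f g x : (\near x, f x = g x) ->
  {for x, continuous f} -> {for x, continuous g}.
Proof.
move=> fg cf; have fgx : f x = g x := nbhs_singleton fg.
suff : g @ x --> f x by rewrite fgx.
exact: (cvg_trans (near_eq_cvg fg) cf).
Qed.

Lemma Ck_eq A k f g : open A -> (forall x, A x -> f x = g x) ->
  Ck A k f -> Ck A k g.
Proof.
move=> oA; elim: k f g => [|k IH] f g fg [cf df].
  split=> // x Ax.
  by apply: near_continuous (cf x Ax); near=> y; apply: fg; near: y;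
    exact: open_nbhs_nbhs.
split=> [x Ax|j].
- by apply: near_continuous (cf x Ax); near=> y; apply: fg; near: y;
    exact: open_nbhs_nbhs.
- have [df1 df2] := df j; split=> [x Ax|].
    by apply: near_eq_derivable (df1 x Ax); near=> y; apply: fg; near: y;
      exact: open_nbhs_nbhs.
  apply: IH df2 => x Ax; apply: near_eq_derive; near=> y.
  by apply: fg; near: y; exact: open_nbhs_nbhs.
Unshelve. all: end_near. Qed.

Lemma CkS A k f : Ck A k.+1 f -> Ck A k f.
Proof.
elim: k f => [|k IH] f; first by case.
case=> cf df; split=> // j; have [df1 df2] := df j.
by split => //; exact: IH.
Qed.

Lemma CkD A k f g : open A -> Ck A k f -> Ck A k g ->
  Ck A k (fun x => f x + g x).
Proof.
move=> oA; elim: k f g => [|k IH] f g [cf df] [cg dg]; split => //.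
- by move=> x Ax; apply: continuousD; [exact: cf|exact: cg].
- by move=> x Ax; apply: continuousD; [exact: cf|exact: cg].
- move=> j; have [df1 df2] := df j; have [dg1 dg2] := dg j; split.
    by move=> x Ax; apply: derivableD; [exact: df1|exact: dg1].
  apply: Ck_eq (IH _ _ df2 dg2) => // x Ax.
  by rewrite /partial [RHS]deriveD//; [exact: df1|exact: dg1].
Qed.

Lemma CkM A k f g : open A -> Ck A k f -> Ck A k g ->
  Ck A k (fun x => f x * g x).
Proof.
move=> oA; elim: k f g => [|k IH] f g Cf Cg; have [cf df] := Cf;
  have [cg dg] := Cg; split => //.
- by move=> x Ax; apply: continuousM; [exact: cf|exact: cg].
- by move=> x Ax; apply: continuousM; [exact: cf|exact: cg].
- move=> j; have [df1 df2] := df j; have [dg1 dg2] := dg j; split.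
    by move=> x Ax; apply: derivableM; [exact: df1|exact: dg1].
  apply: Ck_eq (CkD oA (IH _ _ (CkS Cf) dg2) (IH _ _ (CkS Cg) df2)) => // x Ax.
  by rewrite /partial [RHS]deriveM//; [exact: df1|exact: dg1].
Qed.

Lemma Ck_cst A k (c : R) : Ck A k (cst c).
Proof.
elim: k c => [|k IH] c; split => //; first by move=> x _; exact: cst_continuous.
  by move=> x _; exact: cst_continuous.
move=> j; split; first by move=> x _; exact: derivable_cst.
rewrite (_ : partial j _ = cst 0)//.
by apply/funext => x; rewrite /partial derive_cst.
Qed.

Lemma Ck_coord A k (i : 'I_n) : Ck A k (fun x => x 0 i).
Proof.
have di (x v : E) : derivable (fun y : E => y 0 i) x v.
  exact: (derivable_mxP id x v).1.
case: k => [|k]; split => //; try by move=> x _; exact: coord_continuous.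
move=> j; split => //; rewrite (_ : partial j _ = cst (('e_j : E) 0 i)).
  exact: Ck_cst.
apply/funext => x; rewrite /partial.
have := derive_mx (@derivable_id _ E x 'e_j).
rewrite derive_id => /(congr1 (fun M : E => M 0 i)).
by rewrite [RHS]mxE => /esym.
Qed.

Lemma CkU A B k f : Ck A k f -> Ck B k f -> Ck (A `|` B) k f.
Proof.
elim: k f => [|k IH] f [cf df] [cg dg]; split => //.
- by move=> x [/cf|/cg].
- by move=> x [/cf|/cg].
- move=> j; have [df1 df2] := df j; have [dg1 dg2] := dg j; split.
    by move=> x [/df1|/dg1].
  exact: IH.
Qed.

Lemma Ck_sub A B k f : B `<=` A -> Ck A k f -> Ck B k f.
Proof.
move=> BA; elim: k f => [|k IH] f [cf df]; split => //.
- by move=> x /BA /cf.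
- by move=> x /BA /cf.
- by move=> j; have [df1 df2] := df j; split=> [x /BA /df1//|]; exact: IH.
Qed.

Lemma partial_lin j (a b : R) f g h x : derivable f x 'e_j ->
  derivable g x 'e_j -> derivable h x 'e_j ->
  partial j (fun y => a * f y + b * g y + h y) x =
  a * partial j f x + b * partial j g x + partial j h x.
Proof.
move=> df dg dh; rewrite /partial.
have <- : 'D_'e_j (a *: f) x = a * 'D_'e_j f x by exact: deriveZ.
have <- : 'D_'e_j (b *: g) x = b * 'D_'e_j g x by exact: deriveZ.
have daf : derivable (a *: f) x 'e_j by exact: derivableZ.
have dbg : derivable (b *: g) x 'e_j by exact: derivableZ.
have dfg : derivable (a *: f + b *: g) x 'e_j by exact: derivableD.
by rewrite -(deriveD daf dbg) -(deriveD dfg dh).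
Qed.

Lemma smooth_partial A f j : smooth A f -> smooth A (partial j f).
Proof. by move=> sf k; have [_ /(_ j)[]] := sf k.+1. Qed.

Lemma smooth_coord A (i : 'I_n) : smooth A (fun x => x 0 i).
Proof. by move=> k; exact: Ck_coord. Qed.

Lemma smooth_cst A c : smooth A (fun=> c).
Proof. by move=> k; exact: Ck_cst. Qed.

Lemma smoothD A f g : open A -> smooth A f -> smooth A g ->
  smooth A (fun x => f x + g x).
Proof. by move=> oA sf sg k; exact: CkD. Qed.

Lemma smoothM A f g : open A -> smooth A f -> smooth A g ->
  smooth A (fun x => f x * g x).
Proof. by move=> oA sf sg k; exact: CkM. Qed.

Lemma smoothN A f : open A -> smooth A f -> smooth A (fun x => - f x).
Proof.
move=> oA sf; rewrite (_ : (fun x => _) = (fun x => (-1) * f x)).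
  by apply: smoothM => //; exact: smooth_cst.
by apply/funext => x; rewrite mulN1r.
Qed.

Lemma smooth_eq A f g : open A -> (forall x, A x -> f x = g x) ->
  smooth A f -> smooth A g.
Proof. by move=> oA fg sf k; exact: Ck_eq fg (sf k). Qed.

Lemma smooth_sub A B f : B `<=` A -> smooth A f -> smooth B f.
Proof. by move=> BA sf k; exact: Ck_sub (sf k). Qed.

Lemma smoothU A B f : smooth A f -> smooth B f -> smooth (A `|` B) f.
Proof. by move=> sA sB k; exact: CkU. Qed.

End Smooth.

Section ComplexSmooth.
Variables (R : realType) (n : nat).
Local Notation E := 'rV[R]_n.
Implicit Types (A B Omega : set E) (f g : E -> R[i]) (j : 'I_n).

(* R[i] carries no normed R-module structure, so complex-valued functions of
   real variables are differentiated through their real and imaginary parts. *)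
Definition csmooth A f : Prop :=
  smooth A (fun x => complex.Re (f x)) /\ smooth A (fun x => complex.Im (f x)).

Definition cpartial j f : E -> R[i] := fun x =>
  partial j (fun y => complex.Re (f y)) x +i*
  partial j (fun y => complex.Im (f y)) x.

Definition supp f : set E := closure [set x | f x != 0].

Lemma ReM (z w : R[i]) : complex.Re (z * w) =
  complex.Re z * complex.Re w - complex.Im z * complex.Im w.
Proof. by case: z w => [a b] [c d]. Qed.

Lemma ImM (z w : R[i]) : complex.Im (z * w) =
  complex.Re z * complex.Im w + complex.Im z * complex.Re w.
Proof. by case: z w => [a b] [c d]. Qed.

Lemma csmooth_cst A c : csmooth A (fun=> c).
Proof. by split; exact: smooth_cst. Qed.

Lemma csmoothD A f g : open A -> csmooth A f -> csmooth A g ->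
  csmooth A (fun x => f x + g x).
Proof.
move=> oA [rf mf] [rg mg]; split.
  by apply: (smooth_eq oA _ (smoothD oA rf rg)) => x _; rewrite raddfD.
by apply: (smooth_eq oA _ (smoothD oA mf mg)) => x _; rewrite raddfD.
Qed.

Lemma csmoothM A f g : open A -> csmooth A f -> csmooth A g ->
  csmooth A (fun x => f x * g x).
Proof.
move=> oA [rf mf] [rg mg]; split.
  apply: (smooth_eq oA) (smoothD oA (smoothM oA rf rg)
    (smoothN oA (smoothM oA mf mg))) => x _.
  by rewrite ReM.
apply: (smooth_eq oA) (smoothD oA (smoothM oA rf mg) (smoothM oA mf rg)) => x _.
by rewrite ImM.
Qed.

Lemma csmooth_eq A f g : open A -> (forall x, A x -> f x = g x) ->
  csmooth A f -> csmooth A g.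
Proof.
move=> oA fg [rf mf]; split; first by apply: smooth_eq rf => // x /fg ->.
by apply: smooth_eq mf => // x /fg ->.
Qed.

Lemma csmooth_sub A B f : B `<=` A -> csmooth A f -> csmooth B f.
Proof. by move=> BA [rf mf]; split; exact: smooth_sub BA _. Qed.

Lemma csmoothU A B f : csmooth A f -> csmooth B f -> csmooth (A `|` B) f.
Proof. by move=> [? ?] [? ?]; split; exact: smoothU. Qed.

Lemma csmooth_coord A (i : 'I_n) : csmooth A (fun x => (x 0 i)%:C).
Proof. by split => /=; [exact: smooth_coord|exact: smooth_cst]. Qed.

Lemma csmooth_cpartial A f j : csmooth A f -> csmooth A (cpartial j f).
Proof. by move=> [rf mf]; split; exact: smooth_partial. Qed.

Lemma supp_eq0 f x : ~ supp f x -> f x = 0.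
Proof.
by move=> sx; apply/eqP; apply: contrapT => /negP fx; apply: sx;
  exact: subset_closure.
Qed.

Lemma open_suppC f : open (~` supp f).
Proof. by apply: closed_openC; exact: closed_closure. Qed.

Lemma supp_sub f g : (forall x, ~ supp f x -> g x = 0) -> supp g `<=` supp f.
Proof.
move=> fg; rewrite [supp f](closure_id _).1; last exact: closed_closure.
apply: closure_subset => x /= gx; apply: contrapT => /fg gx0.
by rewrite gx0 eqxx in gx.
Qed.

Lemma supp_cpartial f j : supp (cpartial j f) `<=` supp f.
Proof.
apply: supp_sub => x sx.
have f0 : \near x, f x = 0.
  near=> y; apply: supp_eq0; near: y; apply: open_nbhs_nbhs; split => //.
  exact: open_suppC.
have p0 (h : R[i] -> R) : h 0 = 0 -> partial j (fun y => h (f y)) x = 0.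
  move=> h0; rewrite -(derive_cst (0 : R) x 'e_j).
  by apply: near_eq_derive; near=> y; rewrite (_ : f y = 0)//; near: y.
by rewrite /cpartial !p0.
Unshelve. all: end_near. Qed.

End ComplexSmooth.

Section TestFunctions.
Variables (R : realType) (n : nat) (Omega : set 'rV[R]_n).
Local Notation E := 'rV[R]_n.

(* An element of D(Omega) is represented by its extension by 0 to the whole
   space; as its support is a compact subset of Omega, this extension is
   smooth on the whole space. *)
Definition is_test (phi : E -> R[i]^o) : Prop :=
  [/\ csmooth setT phi, compact (supp phi) & supp phi `<=` Omega].

Definition test_pred : {pred E -> R[i]^o} := [pred phi | `[< is_test phi >]].

Lemma test_predP phi : reflect (is_test phi) (phi \in test_pred).
Proof. exact: asboolP. Qed.

Lemma test_submod_closed : submod_closed test_pred.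
Proof.
split.
  have s0 : supp (0 : E -> R[i]^o) = set0.
    rewrite /supp (_ : [set x | _] = set0) ?closure0//.
    by rewrite -subset0 => x /=; rewrite eqxx.
  apply/test_predP; split; rewrite ?s0//; [exact: csmooth_cst|exact: compact0].
move=> a f g /test_predP[sf cf oF] /test_predP[sg cg oG]; apply/test_predP.
have sfg : supp (a *: f + g) `<=` supp f `|` supp g.
  rewrite /supp -closureU; apply: closure_subset => x /= fgx.
  have [fx|fx] := eqVneq (f x) 0; last by left.
  have [gx|gx] := eqVneq (g x) 0; last by right.
  by case/eqP: fgx; change (a * f x + g x = 0); rewrite fx gx mulr0 addr0.
split.
- apply: (csmoothD openT) sg; apply: (csmoothM openT) sf; exact: csmooth_cst.
- by apply: subclosed_compact sfg; [exact: closed_closure|exact: compactU].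
- by apply: subset_trans sfg _; rewrite subUset; split.
Qed.

HB.instance Definition _ := GRing.isSubmodClosed.Build _ _ test_pred
  test_submod_closed.

Record testfun := TestFun {
  testval :> E -> R[i]^o;
  testvalP : testval \in test_pred }.

HB.instance Definition _ := [isSub for testval].
HB.instance Definition _ := [Choice of testfun by <:].
HB.instance Definition _ := [SubChoice_isSubLmodule of testfun by <:].

Lemma testfunP (phi : testfun) : is_test phi.
Proof. by apply/test_predP; exact: testvalP. Qed.

Lemma testfun_ext (phi psi : testfun) : (forall x, phi x = psi x) -> phi = psi.
Proof. by move=> /funext e; exact: val_inj. Qed.

Lemma test_cpartial_subproof (j : 'I_n) (phi : testfun) :
  cpartial j phi \in test_pred.
Proof.
have [sp cp op] := testfunP phi; apply/test_predP; split.
- exact: csmooth_cpartial.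
- apply: subclosed_compact (@supp_cpartial _ _ phi j) => //.
  exact: closed_closure.
- exact: subset_trans (@supp_cpartial _ _ phi j) op.
Qed.

Definition tpartial (j : 'I_n) (phi : testfun) : testfun :=
  TestFun (test_cpartial_subproof j phi).

Lemma csmooth_derivable A (f : E -> R[i]) x j : csmooth A f -> A x ->
  derivable (fun y => complex.Re (f y)) x 'e_j /\
  derivable (fun y => complex.Im (f y)) x 'e_j.
Proof.
by move=> [rf mf] Ax; have [_ /(_ j)[+ _]] := rf 1%N; move=> /(_ x Ax);
  have [_ /(_ j)[+ _]] := mf 1%N; move=> /(_ x Ax).
Qed.

Lemma tpartial_is_linear j : linear (tpartial j).
Proof.
move=> a f g; apply: testfun_ext => x.
have [sf _ _] := testfunP f; have [sg _ _] := testfunP g.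
have [rf mf] := csmooth_derivable j sf (I : setT x).
have [rg mg] := csmooth_derivable j sg (I : setT x).
have re : (fun y => complex.Re ((a *: f + g) y)) =
    (fun y => complex.Re a * complex.Re (f y) +
              - complex.Im a * complex.Im (f y) + complex.Re (g y)).
  by apply/funext => y; rewrite raddfD/= ReM mulNr.
have im : (fun y => complex.Im ((a *: f + g) y)) =
    (fun y => complex.Re a * complex.Im (f y) +
              complex.Im a * complex.Re (f y) + complex.Im (g y)).
  by apply/funext => y; rewrite raddfD/= ImM.
have -> : tpartial j (a *: f + g) x =
    partial j (fun y => complex.Re ((a *: f + g) y)) x +i*
    partial j (fun y => complex.Im ((a *: f + g) y)) x by [].
rewrite re im (partial_lin _ _ rf mf rg) (partial_lin _ _ mf rf mg).
have -> : (a *: tpartial j f + tpartial j g) x =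
    a * cpartial j f x + cpartial j g x by [].
by case: (a) => ra ia; rewrite /cpartial; simpc.
Qed.

HB.instance Definition _ j := GRing.isLinear.Build R[i] testfun testfun _
  (tpartial j) (tpartial_is_linear j).

Section Multiplication.
Variables (oOmega : open Omega) (f : E -> R[i]) (sf : csmooth Omega f).

Lemma test_mul_subproof (phi : testfun) :
  (fun x => f x * phi x) \in test_pred.
Proof.
have [sp cp op] := testfunP phi; apply/test_predP.
have ss : supp (fun x => f x * phi x) `<=` supp phi.
  by apply: supp_sub => x /supp_eq0 ->; rewrite mulr0.
split.
- rewrite -(setUv Omega).
  have : csmooth (Omega `|` ~` supp phi) (fun x => f x * phi x).
    apply: csmoothU.
      by apply: csmoothM => //; exact: csmooth_sub sp.
    apply: (csmooth_eq (@open_suppC _ _ phi)) (csmooth_cst _ 0) => x.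
    by move=> /supp_eq0 ->; rewrite mulr0.
  by apply: csmooth_sub; apply: setUS; exact: subsetC.
- by apply: subclosed_compact ss => //; exact: closed_closure.
- exact: subset_trans op.
Qed.

Definition tmul (phi : testfun) : testfun := TestFun (test_mul_subproof phi).

Lemma tmul_is_linear : linear tmul.
Proof.
move=> a g h; apply: testfun_ext => x /=.
by rewrite [LHS]mulrDr [f x * _]mulrCA.
Qed.

HB.instance Definition _ := GRing.isLinear.Build R[i] testfun testfun _
  tmul tmul_is_linear.

End Multiplication.

Definition dpartial (j : 'I_n) : {linear dual testfun -> dual testfun} :=
  - transpose (tpartial j).

(* A function in C^oo(Omega) is represented by a function on the whole space
   that is smooth on Omega; its values outside Omega do not matter, since test
   functions vanish there. *)
Definition dmul (oOmega : open Omega) (f : E -> R[i]) (sf : csmooth Omega f) :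
  {linear dual testfun -> dual testfun} := transpose (tmul oOmega sf).

Lemma dpartialE j (T : dual testfun) phi :
  dpartial j T phi = - T (tpartial j phi).
Proof. by []. Qed.

Lemma dmulE oOmega f (sf : csmooth Omega f) (T : dual testfun) phi :
  dmul oOmega sf T phi = T (tmul oOmega sf phi).
Proof. by []. Qed.

End TestFunctions.

Section Lewy.
Variables (R : realType) (Omega : set 'rV[R]_3) (oOmega : open Omega).

Local Notation i1 := (@Ordinal 3 0 isT).
Local Notation i2 := (@Ordinal 3 1 isT).
Local Notation i3 := (@Ordinal 3 2 isT).

Definition lewy_coef (x : 'rV[R]_3) : R[i] :=
  2 * 'i * ((x 0 i1)%:C + 'i * (x 0 i2)%:C).

Lemma csmooth_lewy_coef : csmooth Omega lewy_coef.
Proof.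
apply: csmoothM => //; first exact: csmooth_cst.
apply: csmoothD => //; first exact: csmooth_coord.
by apply: csmoothM => //; [exact: csmooth_cst|exact: csmooth_coord].
Qed.

Definition lewy : {linear dual (testfun Omega) -> dual (testfun Omega)} :=
  dpartial Omega i1 + 'i *: dpartial Omega i2
  - (dmul oOmega csmooth_lewy_coef \o dpartial Omega i3).

Lemma lewyE (T : dual (testfun Omega)) :
  lewy T = dpartial Omega i1 T + 'i *: dpartial Omega i2 T
           - dmul oOmega csmooth_lewy_coef (dpartial Omega i3 T).
Proof. by []. Qed.

End Lewy.

(* Main.v *)
From HB Require Import structures.
Require Import Defs.
From mathcomp Require Import all_boot all_order all_algebra.
From mathcomp Require Import complex.
From mathcomp Require Import all_classical all_reals all_analysis.
From mathcomp Require Import ring lra.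

Set Implicit Arguments.
Unset Strict Implicit.

Import Order.TTheory.
Import GRing.Theory Num.Theory numFieldNormedType.Exports.
Local Open Scope classical_set_scope.
Local Open Scope ring_scope.

(** The co-dual of the Lewy operator is
    [O phi = - d1 phi - i d2 phi + d3 (c phi)], [c = 2 i (x1 + i x2)].
    If [O phi = 0], integrating over a plane [x1 = x] shows that
    [F x = \int\int Re (phi (x, y, t)) dy dt] has zero derivative, hence is [0]
    by compactness of the support.  If [h] is a CR function, i.e. is killed by
    the derivation [d1 + i d2 - c d3], then [O (h phi) = h O phi = 0], so the
    same holds for [h phi].  The functions [z = x1 + i x2] and
    [w = x3 + i |z|^2] are CR, and every polynomial in [(y, t)] on a given plane
    [x1 = x] is the restriction of a polynomial in [z] and [w].  So all moments
    of [phi] on the plane vanish, and [phi = 0].  Surjectivity of [transpose O]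
    on the algebraic dual is then the extension of a linear form from the range
    of [O] to the whole space. *)

(** * Algebraic duals *)

Section LinearExtension.
Variables (K : fieldType) (V : lmodType K).
Implicit Types G : set (V * K).

(** A partially defined linear form is encoded by its graph, so that extending the form is inclusion
    of sets. Given linearity, the last clause is single-valuedness. *)
Definition linear_graph G :=
  [/\ G (0, 0),
      forall a p q, G p -> G q -> G (a *: p.1 + q.1, a * p.2 + q.2) &
      forall k, G (0, k) -> k = 0].

Lemma linear_graph_uniq G v k l :
  linear_graph G -> G (v, k) -> G (v, l) -> k = l.
Proof.
move=> [_ Glin G0] Gk Gl; apply/eqP; rewrite -subr_eq0; apply/eqP/G0.
by have := Glin (-1) _ _ Gl Gk; rewrite /= scaleN1r addNr mulN1r addrC.
Qed.

(** The form is extended to the span of its domain and [v] by the value 0 at [v]. It stays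
    single-valued: if [G] contained [(- a *: v, k)] with [a != 0], scaling by [- a^-1] would put [v]
    in the domain of [G]. *)
Lemma linear_graph_adjoin G v : linear_graph G -> (forall k, ~ G (v, k)) ->
  linear_graph [set p | exists a, G (p.1 - a *: v, p.2)].
Proof.
move=> [G0 Glin Gfun] Gv; split => /=.
- by exists 0; rewrite scale0r subr0.
- move=> a p q [b Gp] [c Gq]; exists (a * b + c).
  have /= := Glin a _ _ Gp Gq; congr (G (_, _)).
  by rewrite scalerBr scalerA scalerDl opprD addrACA.
- move=> k [a]; rewrite sub0r.
  have [->|a0] := eqVneq a 0; first by rewrite scale0r oppr0; exact: Gfun.
  move=> /(Glin (- a^-1) _ _)/(_ G0)/=.
  by rewrite scalerN scaleNr opprK scalerA mulVf// scale1r addr0 => /Gv.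
Qed.

(** Zorn's lemma for graphs under inclusion; a maximal graph is total, since otherwise
    [linear_graph_adjoin] enlarges it. *)
Lemma linear_graph_extend G0 : linear_graph G0 ->
  exists G, [/\ linear_graph G, G0 `<=` G & forall v, exists k, G (v, k)].
Proof.
move=> lG0.
(* The empty set is admitted so that the union of the empty chain qualifies. *)
pose P G := G = set0 \/ (linear_graph G /\ G0 `<=` G).
have [|G [PG maxG]] := @Zorn_bigcup _ P.
  move=> F FP Ftot; have [F0|] := pselect (forall X, F X -> X = set0).
    by left; rewrite -subset0 => p [X FX]; rewrite (F0 _ FX).
  move=> /existsNP[X0 /not_implyP[FX0 X0n]]; right.
  have [|[[X00 _ _] G0X0]] := FP _ FX0; first by move/X0n.
  have linF X p : F X -> X p -> linear_graph X.
    by move=> FX Xp; case: (FP _ FX) => [Xe|[]//]; rewrite Xe in Xp.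
  split; last by move=> p /G0X0 ?; exists X0.
  split; first by exists X0.
    move=> a p q [X FX Xp] [Y FY Yq].
    have [XY|YX] := Ftot _ _ FX FY.
      exists Y => //; have [_ + _] := linF _ _ FY Yq; apply => //.
      exact: XY.
    exists X => //; have [_ + _] := linF _ _ FX Xp; apply => //.
    exact: YX.
  by move=> k [X FX Xk]; have [_ _] := linF _ _ FX Xk; exact.
have [lG G0G] : linear_graph G /\ G0 `<=` G.
  (* The maximal set is not empty, because [G0] satisfies [P] and contains [(0, 0)]. *)
  case: PG => // G_eq0; exfalso; apply: (maxG G0); last by right; split.
  by rewrite G_eq0; split=> // sub; apply: (sub (0, 0)); case: lG0.
exists G; split => // v; apply: contrapT => /forallNP Gv.
apply: (maxG _ _ (or_intror (conj (linear_graph_adjoin lG Gv) _))).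
  split=> [p Gp|sub].
    by exists 0; rewrite scale0r subr0; case: p Gp.
  apply: (Gv 0); apply: sub; exists 1.
  by rewrite scale1r subrr; case: lG.
by move=> p /G0G Gp; exists 0; rewrite scale0r subr0; case: p Gp.
Qed.

(** The rule [O v |-> T v] is a well-defined linear form on the range of [O] by injectivity; any
    linear extension of it is a solution [U]. *)
Lemma transpose_surjective (O : {linear V -> V}) (T : dual V) :
  injective O -> exists U : dual V, transpose O U = T.
Proof.
move=> injO; pose G0 : set (V * K) := [set p | exists v, p = (O v, T v)].
have lG0 : linear_graph G0.
  split.
  - by exists 0; rewrite !linear0.
  - by move=> a _ _ [v ->] [w ->]; exists (a *: v + w); rewrite !linearP.
  - by move=> k [v [/esym]]; rewrite -(linear0 O) => /injO -> ->; rewrite linear0.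
have [G [lG G0G Gtot]] := linear_graph_extend lG0.
have [f Gf] := choice Gtot.
have f_linear : linear (f : V -> K^o).
  move=> a u v; apply: (linear_graph_uniq lG (Gf _)).
  by have [_ + _] := lG => /(_ a _ _ (Gf u) (Gf v)).
pose U : dual V := HB.pack f (GRing.isLinear.Build K V K^o *:%R f f_linear).
exists U; apply: linmap_ext => v.
by apply: (linear_graph_uniq lG (Gf _)); apply: G0G; exists v.
Qed.

End LinearExtension.

(** * Integrals and moments on a segment *)

Section SegmentIntegrals.
Variable R : realType.
Local Notation mu := (@lebesgue_measure R).
Implicit Types (a b c s N : R) (f g : R -> R).

Lemma is_derive_continuous f (df : R -> R) :
  (forall x : R, is_derive x (1 : R) f (df x)) -> continuous f.
Proof.
by move=> df1 x; apply/differentiable_continuous/derivable1_diffP; case: (df1 x).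
Qed.

Lemma continuous_integrable_itv a b f :
  continuous f -> mu.-integrable `[a, b] (EFin \o f).
Proof.
move=> cf; apply: continuous_compact_integrable; first exact: segment_compact.
exact: continuous_subspaceT.
Qed.

Lemma Rintegral_itv_cst a b c : a <= b ->
  \int[mu]_(x in `[a, b]) c = c * (b - a).
Proof.
move=> ab; rewrite Rintegral_cst//= lebesgue_measure_itv/= lte_fin.
by move: ab; rewrite le_eqVlt => /predU1P[->|->] //; rewrite ltxx subrr.
Qed.

(** Differentiation under the integral sign, with the constant [C], integrable on a bounded segment,
    as dominating function. *)
Lemma is_derive_Rintegral a b (C : R) (f df : R -> R -> R) :
  (forall x, continuous (f x)) ->
  (forall x y : R, is_derive x (1 : R) (f^~ y) (df x y)) ->
  (forall x y, `|df x y| <= C) ->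
  forall x : R, is_derive x (1 : R) (fun x => \int[mu]_(y in `[a, b]) f x y)
                          (\int[mu]_(y in `[a, b]) df x y).
Proof.
move=> cf dfE dfC x.
have xI : `]x - 1, x + 1[%classic x by rewrite /= in_itv/= ltrBlDr ltrDl ltr01.
have intf (z : R) : `]x - 1, x + 1[%classic z -> mu.-integrable `[a, b] (EFin \o f z).
  by move=> _; exact: continuous_integrable_itv.
have dE z y : partial1of2 f z y = df z y.
  by rewrite partial1of2E; apply: derive_val.
have derf (z y : R) : `]x - 1, x + 1[%classic z -> `[a, b]%classic y ->
    derivable (f^~ y) z 1.
  by case: (dfE z y).
have C0 (y : R) : 0 <= C by apply: le_trans (dfC 0 0).
have intC : mu.-integrable `[a, b] (EFin \o (fun=> C)).
  by apply: continuous_integrable_itv => ?; exact: cst_continuous.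
have dC (z y : R) : `]x - 1, x + 1[%classic z -> `[a, b]%classic y ->
    `|partial1of2 f z y| <= C.
  by rewrite dE.
have mab : measurable (`[a, b]%classic : set (measurableTypeR R)) by [].
apply: DeriveDef.
  have H := @derivable_under_integral R _ _ mu f _ mab _ _ _ xI
    intf derf _ C0 intC dC.
  exact H.
rewrite -derive1E.
rewrite (@differentiation_under_integral R _ _ mu f _ mab _ _ _ xI intf derf _
  C0 intC dC)//.
by apply: eq_Rintegral => y _; rewrite dE.
Qed.

Lemma Rintegral_is_derive a b (F f : R -> R) : a < b ->
  (forall x : R, is_derive x (1 : R) F (f x)) -> continuous f ->
  \int[mu]_(x in `[a, b]) f x = F b - F a.
Proof.
move=> ab dF cf; have cF := is_derive_continuous dF.
rewrite /Rintegral (@continuous_FTC2 _ f F)//.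
- exact: continuous_subspaceT.
- split=> [x _||]; first by case: (dF x).
    exact/cvg_at_right_filter/cF.
  exact/cvg_at_left_filter/cF.
- by move=> x _; rewrite derive1E; apply: derive_val.
Qed.

Lemma continuous_horner (p : {poly R}) : continuous (fun x : R => p.[x]).
Proof.
move=> x; elim/poly_ind: p => [|p c IH].
  by under eq_fun do rewrite horner0; exact: cst_continuous.
under eq_fun do rewrite hornerMXaddC.
rewrite /continuous_at. apply: cvgD; last exact: cvg_cst.
by apply: cvgM => //; exact: IH.
Qed.

Lemma continuous_itv_bounded a b f : continuous f ->
  exists2 C, 0 <= C & forall x, `[a, b]%classic x -> `|f x| <= C.
Proof.
move=> cf; have : compact (f @` `[a, b]%classic).
  apply: continuous_compact; last exact: segment_compact.
  exact: continuous_subspaceT.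
move=> /compact_bounded[M [_ Mf]].
exists (`|M| + 1) => [|x abx]; first by rewrite addr_ge0.
by apply: Mf; [rewrite (le_lt_trans (ler_norm _))// ltrDl|exists x].
Qed.

(* The powers of a parabola that is > 1 exactly near [s] concentrate the
   integral around [s]. *)
Lemma poly_moments_le0 N f s : continuous f -> - N < s < N ->
  (forall p : {poly R}, \int[mu]_(x in `[- N, N]) (f x * p.[x]) = 0) ->
  f s <= 0.
Proof.
move=> cf /andP[Ns sN] fp0; rewrite leNgt; apply/negP => fs0.
have N0 : 0 < N by lra.
have [d d0 [dl dr df]] : exists2 d : R, 0 < d & [/\ - N <= s - d, s + d <= N &
    forall x, `|x - s| <= d -> f s / 2 <= f x].
  have /cvgrPdist_le/(_ (f s / 2)) := cf s.
  move=> /(_ _)/nbhs_ballP[]; first by rewrite divr_gt0.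
  move=> e /= e0 fe.
  (* Halving [e] puts the closed ball of radius [d] inside the open ball of radius [e]; the other
     two bounds keep it inside the segment. *)
  exists (Num.min (e / 2) (Num.min (s + N) (N - s))).
    by rewrite !lt_min divr_gt0//=; apply/andP; split; lra.
  set m := Num.min _ _.
  have m1 : m <= e / 2 by rewrite /m ge_min lexx.
  have m2 : m <= s + N by rewrite /m !ge_min lexx orbT.
  have m3 : m <= N - s by rewrite /m !ge_min lexx !orbT.
  split; [lra|lra|] => x xm.
  have /fe : ball s e x by rewrite -ball_normE/= distrC; lra.
  by rewrite ler_norml => /andP[_]; lra.
(* The factor [(4 * N ^+ 2)^-1] keeps [q] nonnegative on the segment, where [|x - s| <= 2 * N]. *)
pose q : {poly R} := 1 + (4 * N ^+ 2)^-1 *: (d ^+ 2)%:P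
                     - (4 * N ^+ 2)^-1 *: ('X - s%:P) ^+ 2.
have qE x : q.[x] = 1 + (d ^+ 2 - (x - s) ^+ 2) / (4 * N ^+ 2).
  rewrite /q; move: (_^-1) => k; rewrite !hornerE /=; ring.
have N20 : 0 < 4 * N ^+ 2 :> R by rewrite mulr_gt0// exprn_gt0.
have q0 (x : R) : - N <= x <= N -> 0 <= q.[x].
  move=> /andP[x1 x2]; rewrite qE.
  rewrite -[X in X + _](@divff _ (4 * N ^+ 2)) ?gt_eqF// -mulrDl.
  by apply: divr_ge0; [nra|exact: ltW].
have q1 (x : R) : d <= `|x - s| -> q.[x] <= 1.
  move=> dx; rewrite qE gerDl pmulr_lle0 ?invr_gt0// subr_le0.
  by rewrite -[(x - s) ^+ 2]real_normK ?num_real// lerXn2r// nnegrE ltW.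
(* This is [q - 1] at distance [d / 2] from [s], hence a lower bound for it on [J]. *)
pose eta := (3 / 4 * d ^+ 2) / (4 * N ^+ 2).
have eta0 : 0 < eta by rewrite !(divr_gt0, mulr_gt0, exprn_gt0).
have qeta (x : R) : `|x - s| <= d / 2 -> 1 + eta <= q.[x].
  move=> xd; rewrite qE lerD2l ler_pM2r ?invr_gt0//.
  have : `|x - s| ^+ 2 <= (d / 2) ^+ 2 by rewrite lerXn2r// nnegrE// divr_ge0// ltW.
  by rewrite real_normK ?num_real//; lra.
have [C C0 fC] := continuous_itv_bounded (- N) N cf.
pose J : set R := `[s - d / 2, s + d / 2]%classic.
pose k n := f s / 2 * (1 + eta) ^+ n.
(* On [J] both factors are bounded below. Elsewhere within distance [d] of [s] the product is
   nonnegative, and farther away [q ^+ n] lies in [[0, 1]], so the product is at least [- C]. *)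
have lb n (x : R) : `[- N, N]%classic x -> (cst (k n) \_ J) x - C <= f x * (q ^+ n).[x].
  move=> Nx; have := Nx; rewrite /= in_itv/= horner_exp => Nx'.
  have fCx := fC _ Nx; have [fC1 fC2] := (lerNnormlW fCx, ler_normlW fCx).
  rewrite patchE; case: ifPn => [|_].
    rewrite inE /J/= in_itv/= => Jx.
    have xd : `|x - s| <= d / 2 by rewrite ler_norml; lra.
    apply: (@le_trans _ _ (k n)); first by lra.
    have fx : f s / 2 <= f x by apply: df; lra.
    apply: ler_pM => //; rewrite ?divr_ge0 ?exprn_ge0 ?addr_ge0 ?(ltW fs0) ?(ltW eta0)//.
    by rewrite lerXn2r ?qeta// nnegrE ?q0// addr_ge0 ?ltW.
  rewrite sub0r; have [xd|/ltW xd] := leP `|x - s| d.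
    apply: (@le_trans _ _ 0); first by rewrite oppr_le0.
    apply: mulr_ge0; last by rewrite exprn_ge0 ?q0.
    by apply: le_trans (df _ xd); rewrite divr_ge0// ltW.
  have qn1 : 0 <= q.[x] ^+ n <= 1 by rewrite exprn_ge0 ?q0//= exprn_ile1 ?q0 ?q1.
  have /andP[qn0 qn1'] := qn1.
  have [fx0|fx0] := leP 0 (f x).
    by apply: (@le_trans _ _ 0); [rewrite oppr_le0|exact: mulr_ge0].
  by apply: le_trans fC1 _; rewrite ler_nMr.
have JN : J `<=` `[- N, N]%classic.
  by move=> x; rewrite /J /= !in_itv/=; lra.
have mJ : measurable (J : set (measurableTypeR R)) by exact: measurable_itv.
have icst (c : R) : mu.-integrable `[- N, N] (EFin \o cst c).
  by apply: continuous_integrable_itv => ?; exact: cst_continuous.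
have iJ n : mu.-integrable `[- N, N] (EFin \o (cst (k n) \_ J)).
  have Jk : mu.-integrable J (EFin \o cst (k n)).
    by apply: continuous_integrable_itv => ?; exact: cst_continuous.
  have := (integrable_mkcond _ mJ).1 Jk; rewrite restrict_EFin.
  by apply: integrableS.
(* Integrating [lb]: [J] has length [d], the segment has length [2 * N], and the moment on the right
   vanishes. *)
have main n : k n * d <= C * (2 * N).
  have : \int[mu]_(x in `[- N, N]) ((cst (k n) \_ J) x - C)
      <= \int[mu]_(x in `[- N, N]) (f x * (q ^+ n).[x]).
    apply: le_Rintegral => //.
    - under [X in _.-integrable _ X]eq_fun do rewrite /= EFinB.
      apply: integrableB; [exact: measurable_itv|exact: iJ|exact: (icst C)].
    - apply: continuous_integrable_itv => x.
      by apply: continuousM; [exact: cf|exact: continuous_horner].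
    - by move=> x; exact: lb.
  rewrite fp0 RintegralB//; last exact: icst.
  rewrite -Rintegral_mkcondr (setIidr JN) !Rintegral_itv_cst; lra.
(* The left side of [main] grows without bound in [n], by the Bernoulli estimate
   [n%:R * eta <= (1 + eta) ^+ n] proved in the final induction. *)
have [n] : exists n, C * (2 * N) < f s / 2 * d * (n%:R * eta).
  have c0 : 0 < f s / 2 * d * eta by rewrite mulr_gt0// mulr_gt0// divr_gt0.
  exists (Num.truncn (C * (2 * N) / (f s / 2 * d * eta))).+1.
  by rewrite [ltRHS]mulrCA -(ltr_pdivrMr _ _ c0) truncnS_gt.
apply/negP; rewrite -leNgt; apply: le_trans (main n).
rewrite /k [leRHS]mulrAC ler_pM2l ?mulr_gt0 ?divr_gt0//.
elim: n => [|n IH]; first by rewrite mul0r expr0.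
rewrite exprSr -natr1.
have : 1 <= (1 + eta) ^+ n by rewrite exprn_ege1// lerDl ltW.
by nra.
Qed.

Lemma poly_moments_eq0 N f s : continuous f -> - N < s < N ->
  (forall p : {poly R}, \int[mu]_(x in `[- N, N]) (f x * p.[x]) = 0) ->
  f s = 0.
Proof.
move=> cf Ns fp0; apply/eqP; rewrite eq_le (poly_moments_le0 cf Ns fp0)/=.
rewrite -oppr_le0; apply: (@poly_moments_le0 N (fun x => - f x)) => //.
  by move=> x; apply: continuousN; exact: cf.
move=> p; rewrite -[RHS](fp0 (- p)); apply: eq_Rintegral => x _.
by rewrite hornerN mulNr mulrN.
Qed.

End SegmentIntegrals.

(** * Partial integrals of compactly supported functions *)

Section PartialIntegrals.
Variable R : realType.
Local Notation mu := (@lebesgue_measure R).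
Local Notation E := 'rV[R]_3.
Local Notation i1 := (@Ordinal 3 0 isT).
Local Notation i2 := (@Ordinal 3 1 isT).
Local Notation i3 := (@Ordinal 3 2 isT).
Implicit Types (f g : E -> R) (x y t : R).

Definition point3 x y t : E := \row_i [:: x; y; t]`_i.

(** Along a line of direction ['e_j], the difference quotient of [f \o l] is the directional
    difference quotient of [f] itself. *)
Lemma is_derive_line f (j : 'I_3) (l : R -> E) x :
  (forall h, l (h + x) = h *: 'e_j + l x) -> derivable f (l x) 'e_j ->
  is_derive x (1 : R) (f \o l) (partial j f (l x)).
Proof.
move=> lE df.
have fE : (fun h => h^-1 *: ((f \o l \o shift x) (h *: (1 : R)) - (f \o l) x)) =
          (fun h => h^-1 *: ((f \o shift (l x)) (h *: 'e_j) - f (l x))).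
  apply/funext => h /=; congr (_ *: (f _ - _)).
  by rewrite -lE [h%:A]mulr1.
by split; rewrite /derivable /derive fE.
Qed.

Lemma smooth_derivable f j p : smooth setT f -> derivable f p 'e_j.
Proof. by move=> sf; have [_ /(_ j)[+ _]] := sf 1%N; exact. Qed.

Lemma smooth_continuous f : smooth setT f -> continuous f.
Proof. by move=> sf p; have [+ _] := sf 0%N; apply. Qed.

Lemma is_derive_point1 f x y t : smooth setT f ->
  is_derive x (1 : R) (fun x => f (point3 x y t))
    (partial i1 f (point3 x y t)).
Proof.
move=> sf; apply: (@is_derive_line f i1 (fun x => point3 x y t)).
  move=> h; apply/rowP => -[[|[|[|//]]] i] /=; rewrite !mxE/= ?eqxx.
  - by rewrite mulr1.
  - by rewrite mulr0 add0r.
  - by rewrite mulr0 add0r.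
exact: smooth_derivable.
Qed.

Lemma is_derive_point2 f x y t : smooth setT f ->
  is_derive y (1 : R) (fun y => f (point3 x y t))
    (partial i2 f (point3 x y t)).
Proof.
move=> sf; apply: (@is_derive_line f i2 (fun y => point3 x y t)).
  move=> h; apply/rowP => -[[|[|[|//]]] i] /=; rewrite !mxE/= ?eqxx.
  - by rewrite mulr0 add0r.
  - by rewrite mulr1.
  - by rewrite mulr0 add0r.
exact: smooth_derivable.
Qed.

Lemma is_derive_point3 f x y t : smooth setT f ->
  is_derive t (1 : R) (fun t => f (point3 x y t))
    (partial i3 f (point3 x y t)).
Proof.
move=> sf; apply: (@is_derive_line f i3 (fun t => point3 x y t)).
  move=> h; apply/rowP => -[[|[|[|//]]] i] /=; rewrite !mxE/= ?eqxx.
  - by rewrite mulr0 add0r.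
  - by rewrite mulr0 add0r.
  - by rewrite mulr1.
exact: smooth_derivable.
Qed.

Lemma smooth_continuous_point2 f x t : smooth setT f ->
  continuous (fun y => f (point3 x y t)).
Proof.
by move=> sf; apply: is_derive_continuous => y; exact: is_derive_point2.
Qed.

Section CompactSupport.
Variables (K : set E) (N : R).
Hypotheses (compactK : compact K) (N_gt0 : 0 < N).
Hypothesis K_lt : forall p, K p -> forall i, `|p 0 i| < N.

(** Supports are only asked to lie in a fixed [K], so the class is stable under [partial] and a
    single [N] serves all the functions involved. *)
Definition smooth_supported f := smooth setT f /\ forall p, ~ K p -> f p = 0.

Lemma smooth_supported_partial j f :
  smooth_supported f -> smooth_supported (partial j f).
Proof.
move=> [sf f0]; split=> [|p Kp]; first exact: smooth_partial.
rewrite -(derive_cst (0 : R) p 'e_j).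
apply: near_eq_derive; near=> q; apply: f0; near: q.
apply: open_nbhs_nbhs; split=> //.
by apply: closed_openC; exact: compact_closed.
Unshelve. all: end_near. Qed.

Lemma smooth_supported_bounded f :
  smooth_supported f -> exists C : R, forall p, `|f p| <= C.
Proof.
move=> [sf f0]; have : compact (f @` K).
  apply: continuous_compact => //; apply: continuous_subspaceT.
  exact: smooth_continuous.
move=> /compact_bounded[M [_ fM]].
exists (`|M| + 1) => p; have [Kp|/f0->] := pselect (K p).
  by apply: fM; [rewrite (le_lt_trans (ler_norm _))// ltrDl|exists p].
by rewrite normr0 addr_ge0.
Qed.

Lemma smooth_supported_eq0 f x y t : smooth_supported f ->
  (N <= `|x|) || (N <= `|y|) || (N <= `|t|) -> f (point3 x y t) = 0.
Proof.
move=> [_ f0] NK; apply: f0 => /K_lt lt_N.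
have := (lt_N i1, lt_N i2, lt_N i3); rewrite !mxE/= => -[[]].
by case/orP: NK => [/orP[]|]; rewrite leNgt => /negP.
Qed.

Definition int2 f x t := \int[mu]_(y in `[- N, N]) f (point3 x y t).
Definition int23 f x := \int[mu]_(t in `[- N, N]) int2 f x t.

Lemma is_derive_int2_t f x t : smooth_supported f ->
  is_derive t (1 : R) (int2 f x) (int2 (partial i3 f) x t).
Proof.
move=> sf; have [C fC] := smooth_supported_bounded (smooth_supported_partial i3 sf).
case: sf => sf _.
apply: (@is_derive_Rintegral R (- N) N C (fun t y => f (point3 x y t))
  (fun t y => partial i3 f (point3 x y t))) => // [{}t|{}t y].
  exact: smooth_continuous_point2.
exact: is_derive_point3.
Qed.

Lemma is_derive_int2_x f x t : smooth_supported f ->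
  is_derive x (1 : R) (fun x => int2 f x t) (int2 (partial i1 f) x t).
Proof.
move=> sf; have [C fC] := smooth_supported_bounded (smooth_supported_partial i1 sf).
case: sf => sf _.
apply: (@is_derive_Rintegral R (- N) N C (fun x y => f (point3 x y t))
  (fun x y => partial i1 f (point3 x y t))) => // [{}x|{}x y].
  exact: smooth_continuous_point2.
exact: is_derive_point1.
Qed.

Lemma continuous_int2 f x : smooth_supported f -> continuous (int2 f x).
Proof.
by move=> sf; apply: is_derive_continuous => t; exact: is_derive_int2_t.
Qed.

(** Applied to [partial i1 f], this is the domination needed to differentiate under the outer
    integral in [is_derive_int23]. *)
Lemma int2_bounded f : smooth_supported f ->
  exists C : R, forall x t, `|int2 f x t| <= C.
Proof.
move=> sf; have [C fC] := smooth_supported_bounded sf.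
have cf x t := @smooth_continuous_point2 f x t sf.1.
exists (C * (N - - N)) => x t; rewrite /int2.
apply: le_trans (le_normr_Rintegral _ _) _ => //.
  exact: continuous_integrable_itv.
rewrite -Rintegral_itv_cst; last by rewrite ge0_cp// ltW.
apply: le_Rintegral => //.
- apply: (@continuous_integrable_itv R _ _ (fun y => `|f (point3 x y t)|)) => y.
  by apply: cvg_norm; exact: cf.
- by apply: continuous_integrable_itv => y; exact: cst_continuous.
Qed.

Lemma is_derive_int23 f x : smooth_supported f ->
  is_derive x (1 : R) (int23 f) (int23 (partial i1 f) x).
Proof.
move=> sf; have [C fC] := int2_bounded (smooth_supported_partial i1 sf).
apply: (@is_derive_Rintegral R (- N) N C (int2 f) (int2 (partial i1 f))) => //.
  by move=> {}x; exact: continuous_int2.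
by move=> {}x t; exact: is_derive_int2_x.
Qed.

Let NN : - N < N.
Proof. by rewrite (lt_trans _ N_gt0)// oppr_lt0. Qed.

Lemma int23_partial2 f x : smooth_supported f -> int23 (partial i2 f) x = 0.
Proof.
(* The right-hand 0 becomes the integral of the constant 0, so that integrands can be compared
   pointwise; the inner one is a boundary term at [y = N] and [y = - N], off the support. *)
move=> sf; rewrite /int23 -[RHS](mul0r (N - - N)) -Rintegral_itv_cst ?ltW//.
apply: eq_Rintegral => t _; rewrite /int2.
rewrite (@Rintegral_is_derive R _ _ (fun y => f (point3 x y t)) _ NN
  (fun y => is_derive_point2 x y t sf.1)); last first.
  exact: smooth_continuous_point2 (smooth_supported_partial i2 sf).1.
by rewrite !smooth_supported_eq0 ?subrr// ?normrN (ger0_norm (ltW N_gt0)) lexx orbT.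
Qed.

(** Here the outer integrand is [int2 (partial i3 f) x], the derivative of [int2 f x], so the
    fundamental theorem applies to the outer integral. *)
Lemma int23_partial3 f x : smooth_supported f -> int23 (partial i3 f) x = 0.
Proof.
move=> sf; rewrite /int23 (@Rintegral_is_derive R _ _ (int2 f x) _ NN
  (fun t => is_derive_int2_t x t sf)); last first.
  by apply: continuous_int2; exact: smooth_supported_partial.
have int2_0 t : N <= `|t| -> int2 f x t = 0.
  move=> Nt; rewrite /int2 -[RHS](mul0r (N - - N)) -Rintegral_itv_cst ?ltW//.
  by apply: eq_Rintegral => y _; rewrite smooth_supported_eq0// Nt orbT.
by rewrite !int2_0 ?subrr// ?normrN (ger0_norm (ltW N_gt0)).
Qed.

Lemma int23D f g x : smooth_supported f -> smooth_supported g ->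
  int23 (fun p => f p + g p) x = int23 f x + int23 g x.
Proof.
move=> sf sg; rewrite /int23 -RintegralD//; first last.
- by apply: continuous_integrable_itv; exact: continuous_int2.
- by apply: continuous_integrable_itv; exact: continuous_int2.
apply: eq_Rintegral => t _; rewrite /int2 -RintegralD//.
- by apply: continuous_integrable_itv; exact: smooth_continuous_point2 sf.1.
- by apply: continuous_integrable_itv; exact: smooth_continuous_point2 sg.1.
Qed.

(** The derivative of [int23 u] is the integral of a divergence in the plane, hence 0, and so
    [int23 u] is constant. *)
Lemma int23_eq0 u v w : smooth_supported u -> smooth_supported v ->
  smooth_supported w -> partial i1 u = (fun p => partial i2 v p + partial i3 w p) ->
  forall x, int23 u x = 0.
Proof.
move=> su sv sw uvw x.
have du0 (z : R) : is_derive z (1 : R) (int23 u) 0.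
  have <- : int23 (partial i1 u) z = 0; last exact: is_derive_int23.
  rewrite uvw (int23D z (smooth_supported_partial i2 sv)
    (smooth_supported_partial i3 sw)).
  by rewrite (int23_partial2 z sv) (int23_partial3 z sw) addr0.
(* The constant is evaluated on the plane [x1 = N], which misses [K]. *)
rewrite (is_derive_0_is_cst x N du0).
rewrite /int23 -[RHS](mul0r (N - - N)) -Rintegral_itv_cst ?ltW//.
apply: eq_Rintegral => t _.
rewrite /int2 -[RHS](mul0r (N - - N)) -Rintegral_itv_cst ?ltW//.
apply: eq_Rintegral => y _.
by rewrite smooth_supported_eq0// (ger0_norm (ltW N_gt0)) lexx.
Qed.

Lemma smooth_horner (p : {poly R}) f : smooth setT f ->
  smooth setT (fun z => p.[f z]).
Proof.
move=> sf; elim/poly_ind: p => [|p c IH].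
  by under eq_fun do rewrite horner0; exact: smooth_cst.
under eq_fun do rewrite hornerMXaddC.
apply: smoothD; [exact: openT| |exact: smooth_cst].
by apply: smoothM => //; exact: openT.
Qed.

(** The one-variable result is used twice: for fixed [p], the [p]-moment in [y] is a continuous
    function of [t] with zero moments, hence 0; then [y |-> f (point3 x y t)] has zero moments.
    Outside the square [f] vanishes by support. *)
Lemma moments_eq0 f x : smooth_supported f ->
  (forall p q : {poly R}, \int[mu]_(t in `[- N, N])
    ((\int[mu]_(y in `[- N, N]) (f (point3 x y t) * p.[y])) * q.[t]) = 0) ->
  forall y t, f (point3 x y t) = 0.
Proof.
move=> sf fpq y t.
have [ty|] := boolP ((`|y| < N) && (`|t| < N)); last first.
  by rewrite negb_and -!leNgt => Nyt; rewrite smooth_supported_eq0// -orbA Nyt orbT.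
have /andP[] := ty; rewrite !ltr_norml => Ny Nt {ty}.
apply: (poly_moments_eq0 (@smooth_continuous_point2 f x t sf.1) Ny) => p.
pose fp z := f z * p.[z 0 i2].
have sfp : smooth_supported fp.
  split=> [|z Kz]; last by rewrite /fp sf.2// mul0r.
  apply: smoothM; [exact: openT|exact: sf.1|].
  by apply: smooth_horner; exact: smooth_coord.
have fpE s : int2 fp x s = \int[mu]_(y in `[- N, N]) (f (point3 x y s) * p.[y]).
  by apply: eq_Rintegral => z _; rewrite /fp mxE.
rewrite -fpE; apply: (poly_moments_eq0 (continuous_int2 sfp) Nt) => q.
by rewrite -[RHS](fpq p q); apply: eq_Rintegral => s _; rewrite fpE.
Qed.

End CompactSupport.
End PartialIntegrals.

(** * CR functions *)

Section CauchyRiemann.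
Variable R : realType.
Local Notation E := 'rV[R]_3.
Local Notation i1 := (@Ordinal 3 0 isT).
Local Notation i2 := (@Ordinal 3 1 isT).
Local Notation i3 := (@Ordinal 3 2 isT).
Implicit Types (f g h : E -> R[i]) (z : E).

Lemma ReiM (c : R[i]) : complex.Re ('i * c) = - complex.Im c.
Proof. by rewrite -complexiE Defs.ReM mul0r mul1r sub0r. Qed.

Lemma partial_coord (i j : 'I_3) z : partial j (fun x : E => x 0 i) z = (i == j)%:R.
Proof.
have -> : partial j (fun x : E => x 0 i) z = ('e_j : E) 0 i.
  have := derive_mx (@derivable_id _ E z 'e_j).
  by rewrite derive_id => /(congr1 (fun M : E => M 0 i)); rewrite [RHS]mxE.
by rewrite mxE eqxx.
Qed.

Lemma cpartial_cst j (c : R[i]) z : cpartial j (fun=> c) z = 0 :> R[i].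
Proof. by rewrite /cpartial /partial !derive_cst. Qed.

Lemma cpartial_coord (i j : 'I_3) z :
  cpartial j (fun x : E => ((x 0 i)%:C)%C) z = (i == j)%:R :> R[i].
Proof.
rewrite /cpartial /= partial_coord /partial derive_cst.
by case: (i == j).
Qed.

Lemma partialD (u v : E -> R) j z : smooth setT u -> smooth setT v ->
  partial j (fun x => u x + v x) z = partial j u z + partial j v z.
Proof. by move=> su sv; apply: deriveD; exact: smooth_derivable. Qed.

Lemma partialB (u v : E -> R) j z : smooth setT u -> smooth setT v ->
  partial j (fun x => u x - v x) z = partial j u z - partial j v z.
Proof. by move=> su sv; apply: deriveB; exact: smooth_derivable. Qed.

Lemma partialM (u v : E -> R) j z : smooth setT u -> smooth setT v ->
  partial j (fun x => u x * v x) z = u z * partial j v z + v z * partial j u z.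
Proof. by move=> su sv; apply: deriveM; exact: smooth_derivable. Qed.

Lemma cpartialD f g j z : csmooth setT f -> csmooth setT g ->
  cpartial j (fun x => f x + g x) z = cpartial j f z + cpartial j g z :> R[i].
Proof.
move=> [sf tf] [sg tg]; rewrite /cpartial.
have -> : (fun x => complex.Re (f x + g x)) =
  (fun x => complex.Re (f x) + complex.Re (g x)).
  by apply/funext => x; rewrite raddfD.
have -> : (fun x => complex.Im (f x + g x)) =
  (fun x => complex.Im (f x) + complex.Im (g x)).
  by apply/funext => x; rewrite raddfD.
by rewrite !partialD.
Qed.

Lemma cpartialM f g j z : csmooth setT f -> csmooth setT g ->
  cpartial j (fun x => f x * g x) z =
  f z * cpartial j g z + g z * cpartial j f z :> R[i].
Proof.
move=> [sf tf] [sg tg].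
have sM := @smoothM R 3 setT _ _ openT.
rewrite /cpartial.
have -> : (fun x => complex.Re (f x * g x)) = (fun x =>
  complex.Re (f x) * complex.Re (g x) - complex.Im (f x) * complex.Im (g x)).
  by apply/funext => x; rewrite Defs.ReM.
have -> : (fun x => complex.Im (f x * g x)) = (fun x =>
  complex.Re (f x) * complex.Im (g x) + complex.Im (f x) * complex.Re (g x)).
  by apply/funext => x; rewrite Defs.ImM.
rewrite partialB ?partialD ?partialM//; [|exact: sM..].
case: (f z) (g z) => [a b] [c d] /=; simpc.
by congr (_ +i* _)%C; ring.
Qed.

Definition lewy_fun h z : R[i] :=
  cpartial i1 h z + 'i * cpartial i2 h z - lewy_coef z * cpartial i3 h z.

Definition cr h := csmooth setT h /\ forall z, lewy_fun h z = 0.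

Lemma cr_cst (c : R[i]) : cr (fun=> c).
Proof.
split=> [|z]; first exact: csmooth_cst.
by rewrite /lewy_fun !cpartial_cst !mulr0 addr0 subr0.
Qed.

Lemma crD f g : cr f -> cr g -> cr (fun x => f x + g x).
Proof.
move=> [sf f0] [sg g0]; split=> [|z]; first exact: csmoothD openT sf sg.
rewrite /lewy_fun !cpartialD//.
transitivity (lewy_fun f z + lewy_fun g z); last by rewrite f0 g0 addr0.
by rewrite /lewy_fun; ring.
Qed.

(** By Leibniz's rule [lewy_fun] is a derivation, so its kernel is closed under products. *)
Lemma crM f g : cr f -> cr g -> cr (fun x => f x * g x).
Proof.
move=> [sf f0] [sg g0]; split=> [|z]; first exact: csmoothM openT sf sg.
rewrite /lewy_fun !cpartialM//.
transitivity (f z * lewy_fun g z + g z * lewy_fun f z).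
  by rewrite /lewy_fun; ring.
by rewrite f0 g0 !mulr0 addr0.
Qed.

Lemma cr_horner (p : {poly R[i]}) f : cr f -> cr (fun x => p.[f x]).
Proof.
move=> crf; elim/poly_ind: p => [|p c IH].
  by under eq_fun do rewrite horner0; exact: cr_cst.
under eq_fun do rewrite hornerMXaddC.
by apply: crD; [exact: crM|exact: cr_cst].
Qed.

Definition cr_z z : R[i] := (z 0 i1)%:C%C + 'i * (z 0 i2)%:C%C.

(** Together, [cr_z] and [cr_w] embed the space in [C^2] as the hypersurface [Im w = |z|^2], whose
    tangential Cauchy-Riemann field is the Lewy field up to a factor. *)
Definition cr_w z : R[i] :=
  (z 0 i3)%:C%C + 'i * ((z 0 i1)%:C%C * (z 0 i1)%:C%C +
                        (z 0 i2)%:C%C * (z 0 i2)%:C%C).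

Let csm := @csmooth_coord R 3 setT.
Let csD f g := @csmoothD R 3 setT f g openT.
Let csM f g := @csmoothM R 3 setT f g openT.
Let csc := @csmooth_cst R 3 setT.

Lemma cr_crz : cr cr_z.
Proof.
split=> [|z]; first by apply: csD => //; exact: csM.
rewrite /lewy_fun /cr_z !(cpartialD, cpartialM, cpartial_cst, cpartial_coord)//=;
  try exact: csM.
rewrite !mulr0 !addr0 !mulr1 mulr0 subr0 add0r -expr2 sqrCi subrr//.
Qed.

Lemma cr_crw : cr cr_w.
Proof.
split=> [|z].
  by apply: csD => //; apply: csM => //; apply: csD => //; exact: csM.
rewrite /lewy_fun /cr_w !(cpartialD, cpartialM, cpartial_cst, cpartial_coord)//=;
  try (by repeat first [exact: csM | exact: csD | apply: csM | apply: csD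
                       | exact: csc | exact: csm]).
rewrite /lewy_coef; ring.
Qed.

(* On the plane [x1 = x] the CR function [cr_z] is affine in [x2], and [cr_w]
   differs from [x3] by a polynomial in [cr_z]: polynomials in [x2] and [x3]
   on this plane therefore extend to CR functions. *)
Definition cr_y (x : R) z : R[i] := - 'i * (cr_z z + (- x)%:C%C).
Definition cr_t (x : R) z : R[i] :=
  cr_w z + - 'i * ((x * x)%:C%C + cr_y x z * cr_y x z).

Lemma cr_cry x : cr (cr_y x).
Proof.
by apply: crM; [exact: cr_cst|apply: crD; [exact: cr_crz|exact: cr_cst]].
Qed.

Lemma cr_crt x : cr (cr_t x).
Proof.
apply: crD; [exact: cr_crw|apply: crM; [exact: cr_cst|]].
by apply: crD; [exact: cr_cst|apply: crM; exact: cr_cry].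
Qed.

Lemma cr_y_point3 (x y t : R) : cr_y x (point3 x y t) = y%:C%C.
Proof.
rewrite /cr_y /cr_z !mxE/= raddfN/= addrAC subrr add0r mulrA mulNr -expr2.
by rewrite sqrCi opprK mul1r.
Qed.

(** On this plane [cr_w] equals [t + i (x^2 + y^2)] and [cr_y x] equals [y], so the correction term
    removes the imaginary part. *)
Lemma cr_t_point3 (x y t : R) : cr_t x (point3 x y t) = t%:C%C.
Proof.
by rewrite /cr_t /cr_w cr_y_point3 !mxE/= rmorphM/= mulNr addrK.
Qed.

(** The real polynomials are mapped to complex ones because [cr_y x] is not real off the plane
    [x1 = x]. *)
Definition cr_extension (x : R) (p q : {poly R}) z : R[i] :=
  (map_poly (real_complex R) p).[cr_y x z] *
  (map_poly (real_complex R) q).[cr_t x z].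

Lemma cr_cr_extension x p q : cr (cr_extension x p q).
Proof. by apply: crM; apply: cr_horner; [exact: cr_cry|exact: cr_crt]. Qed.

Lemma cr_extension_point3 (x y t : R) p q :
  cr_extension x p q (point3 x y t) = (p.[y] * q.[t])%:C%C.
Proof.
by rewrite /cr_extension cr_y_point3 cr_t_point3 !horner_map -rmorphM.
Qed.

End CauchyRiemann.

(** * The co-dual of the Lewy operator *)

Section LewyCodual.
Variables (R : realType) (Omega : set 'rV[R]_3) (oOmega : open Omega).
Local Notation mu := (@lebesgue_measure R).
Local Notation E := 'rV[R]_3.
Local Notation i1 := (@Ordinal 3 0 isT).
Local Notation i2 := (@Ordinal 3 1 isT).
Local Notation i3 := (@Ordinal 3 2 isT).
Implicit Types (phi : testfun Omega) (h : E -> R[i]).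
Local Notation D j := (@tpartial R 3 Omega j).

(** Transposition changes the sign of each derivative and reverses compositions, so the coefficient
    ends up inside [D i3]. *)
Definition lewy_codual : {linear testfun Omega -> testfun Omega} :=
  - D i1 - 'i *: D i2
  + (D i3 \o tmul oOmega (csmooth_lewy_coef oOmega)).

Lemma lewyE_codual (T : dual (testfun Omega)) :
  lewy oOmega T = transpose lewy_codual T.
Proof.
apply: linmap_ext => phi; rewrite lewyE.
transitivity (- T (D i1 phi) + 'i * - T (D i2 phi)
  - - T (D i3 (tmul oOmega (csmooth_lewy_coef oOmega) phi))) => //.
rewrite /transpose /=.
transitivity (T (- D i1 phi - 'i *: D i2 phi
  + D i3 (tmul oOmega (csmooth_lewy_coef oOmega) phi))) => //.
by rewrite linearD linearB linearZ/= (linearN T) mulrN opprK.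
Qed.

Lemma lewy_codualE phi z : lewy_codual phi z =
  - cpartial i1 phi z - 'i * cpartial i2 phi z
  + cpartial i3 (fun x => lewy_coef x * phi x) z :> R[i].
Proof. by []. Qed.

Lemma csmooth_sub_setT h : csmooth setT h -> csmooth Omega h.
Proof. exact: csmooth_sub. Qed.

Lemma csmooth_testfun phi : csmooth setT phi.
Proof. by case: (testfunP phi). Qed.

(** Leibniz's rule gives [O (h phi) = h (O phi) - phi (lewy_fun h)], where [O] is [lewy_codual];
    both terms vanish. *)
Lemma lewy_codual_mul_cr phi h (crh : cr h) : lewy_codual phi = 0 ->
  lewy_codual (tmul oOmega (csmooth_sub_setT crh.1) phi) = 0.
Proof.
move=> phi0; apply: testfun_ext => z.
have sp := csmooth_testfun phi.
have scp := csmooth_testfun (tmul oOmega (csmooth_lewy_coef oOmega) phi).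
have [sh h0] := crh.
transitivity (h z * lewy_codual phi z - phi z * lewy_fun h z : R[i]).
  rewrite !lewy_codualE /lewy_fun /=.
  have -> : (fun x => lewy_coef x * (h x * phi x)) =
            (fun x => h x * (lewy_coef x * phi x)).
    by apply/funext => x; rewrite mulrCA.
  rewrite !(cpartialM _ _ sh sp) (cpartialM i3 z sh scp) /=; ring.
by rewrite phi0 h0 !mulr0 subr0.
Qed.

Lemma smooth_supported_testfun phi (K : set E) : supp phi `<=` K ->
  smooth_supported K (fun z => complex.Re (phi z)) /\
  smooth_supported K (fun z => complex.Im (phi z)).
Proof.
move=> phiK; have [sr si] := csmooth_testfun phi.
by split; split=> // z Kz; rewrite supp_eq0// => /phiK.
Qed.

(** The real part of the equation reads [d1 (Re phi) = d2 (Im phi) + d3 (Re (c phi))], the form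
    required by [int23_eq0]. *)
Lemma int23_lewy_codual_eq0 phi (K : set E) N x : compact K -> 0 < N ->
  (forall z, K z -> forall i, `|z 0 i| < N) -> supp phi `<=` K ->
  lewy_codual phi = 0 -> int23 N (fun z => complex.Re (phi z)) x = 0.
Proof.
move=> cK N0 KN phiK phi0.
pose psi := tmul oOmega (csmooth_lewy_coef oOmega) phi.
have psiK : supp psi `<=` K.
  apply: subset_trans phiK; apply: supp_sub => z /supp_eq0 phiz.
  by rewrite /psi/= phiz mulr0.
have [su sv] := smooth_supported_testfun phiK.
have [sw _] := smooth_supported_testfun psiK.
apply: (int23_eq0 cK N0 KN su sv sw).
have ReE (a b c : R[i]) :
    complex.Re (- a - 'i * b + c) = - complex.Re a + complex.Im b + complex.Re c.
  by rewrite -complexiE; case: a b c => [? ?] [? ?] [? ?]; simpc; rewrite /=; ring.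
apply/funext => z.
have : complex.Re (lewy_codual phi z : R[i]) = 0 by rewrite phi0.
by rewrite lewy_codualE ReE /=; lra.
Qed.

Lemma Re_eq0_of_lewy_codual phi z : lewy_codual phi = 0 -> complex.Re (phi z) = 0.
Proof.
move=> phi0; pose K := supp phi.
have cK : compact K by case: (testfunP phi).
have [N N0 KN] : exists2 N : R, 0 < N & forall z, K z -> forall i, `|z 0 i| < N.
  have [M [_ MK]] := compact_bounded cK.
  (* [|M| + 1] exceeds [M] and therefore bounds [K]; one more unit makes the bound strict. *)
  exists (`|M| + 2) => [|x Kx i]; first by rewrite ltr_wpDl.
  apply: (@le_lt_trans _ _ (`|M| + 1)); last by rewrite ltrD2l ltr1n.
  apply: le_trans (MK (`|M| + 1) _ _ Kx).
    by rewrite [leRHS]/Num.norm/= mx_normrE; apply: (le_bigmax _ _ (0, i)).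
  by rewrite (le_lt_trans (ler_norm _))// ltrDl.
have [su _] := smooth_supported_testfun (@subset_refl _ K).
have -> : z = point3 (z 0 i1) (z 0 i2) (z 0 i3).
  by apply/rowP => -[[|[|[|//]]] i]; rewrite mxE/=; congr (z _ _); exact: val_inj.
move: (z 0 i1) (z 0 i2) (z 0 i3) => x y t.
apply: (moments_eq0 cK KN su) => p q.
have crh := cr_cr_extension x p q.
pose psi := tmul oOmega (csmooth_sub_setT crh.1) phi.
have psiK : supp psi `<=` K.
  by apply: supp_sub => v /supp_eq0 phiv; rewrite /psi/= phiv mulr0.
(* On the plane [x1 = x] the multiplier is the real number [p.[y] * q.[t]], so the moment of
   [Re phi] is the plane integral of [Re psi]. *)
rewrite -[RHS](int23_lewy_codual_eq0 x cK N0 KN psiK (lewy_codual_mul_cr crh phi0)).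
apply: eq_Rintegral => s _; rewrite -RintegralZr//.
  apply: eq_Rintegral => v _ /=.
  rewrite cr_extension_point3 Defs.ReM/= mul0r subr0.
  by rewrite -mulrA mulrC.
have cf : continuous (fun y : R => complex.Re (phi (point3 x y s)) * p.[y]).
  move=> v; apply: cvgM; last exact: continuous_horner.
  exact: (@smooth_continuous_point2 _ _ x s su.1).
exact: continuous_integrable_itv.
Qed.

(** The kernel is a complex subspace, so the result on real parts also applies to ['i *: phi], whose
    real part is [- Im phi]. *)
Lemma lewy_codual_injective : injective lewy_codual.
Proof.
apply: raddf_inj => phi phi0; apply: testfun_ext => z.
have Re0 := Re_eq0_of_lewy_codual z phi0.
have iphi0 : lewy_codual ('i *: phi) = 0 by rewrite linearZZ phi0 scaler0.
have /eqP := Re_eq0_of_lewy_codual z iphi0.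
rewrite ReiM oppr_eq0 => /eqP Im0.
have Re_Im_eq0 (c : R[i]) : complex.Re c = 0 -> complex.Im c = 0 -> c = 0.
  by case: c => a b /= -> ->.
exact: Re_Im_eq0 Re0 Im0.
Qed.

End LewyCodual.

Unset Implicit Arguments.

Theorem mainTheorem5 (R : realType) (Omega : set 'rV[R]_3)
    (oOmega : open Omega) :
  regular (lewy oOmega) /\
  (forall T : dual (testfun Omega),
     exists U : dual (testfun Omega), lewy oOmega U = T).
Proof.
have inj := @lewy_codual_injective R Omega oOmega.
split=> [|T].
  by exists (lewy_codual oOmega); split=> // T; exact: lewyE_codual.
have [U UT] := transpose_surjective T inj.
by exists U; rewrite lewyE_codual.
Qed.
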